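(* In the steady state of the D-$MAP/G_n^{(a,b)}/1$ queue, the bivariate vector generating function $\widetilde{\boldsymbol{\pi}}^+(x,\xi)=\sum_{n=0}^\infty\sum_{r=a}^b\boldsymbol{\pi}^+(n,r)x^n\xi^r$ of the queue and server content at the departure epoch satisfies, for all complex $x,\xi$ with $|x|\le1$, $|\xi|\le1$ such that $x^b\mathbf{I}-\mathbf{A}^*_b(x)$ is invertible, $$\widetilde{\boldsymbol{\pi}}^+(x,\xi)=\Bigg(\sum_{n=0}^{a-1}\boldsymbol{\phi}^+(n)\Big((\xi^b-\xi^a)\overline{\mathbf{D}}^{\,a-n}\mathbf{A}^*_a(x)\mathbf{A}^*_b(x)+\overline{\mathbf{D}}^{\,a-n}\xi^a x^b\mathbf{A}^*_a(x)-\xi^b x^n\mathbf{A}^*_b(x)\Big)$$ $$\qquad+\sum_{n=a}^{b-1}\boldsymbol{\phi}^+(n)\Big((\xi^b-\xi^n)\mathbf{A}^*_n(x)\mathbf{A}^*_b(x)+\xi^n x^b\mathbf{A}^*_n(x)-\xi^b x^n\mathbf{A}^*_b(x)\Big)\Bigg)\big(x^b\mathbf{I}-\mathbf{A}^*_b(x)\big)^{-1}.$$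
   Context: **Model (D-$MAP/G_n^{(a,b)}/1$, infinite buffer, discrete time).** Fix integers $1\le a\le b$ and $m\ge 1$. All vectors are row vectors of length $m$ except $\boldsymbol{e}$, the column vector of ones; $\mathbf{I}$ is the $m\times m$ identity. Arrivals: a discrete-time Markovian arrival process given by nonnegative $m\times m$ matrices $\mathbf{C}=[C_{ij}]$, $\mathbf{D}=[D_{ij}]$, each with at least one positive entry, such that $\mathbf{C}+\mathbf{D}$ is stochastic and irreducible. In each slot the phase moves from $i$ to $j$ without an arrival with probability $C_{ij}$, and with one arrival with probability $D_{ij}$. Let $\overline{\boldsymbol{\pi}}$ be the stationary probability vector of $\mathbf{C}+\mathbf{D}$ and $\lambda^*=\overline{\boldsymbol{\pi}}\mathbf{D}\boldsymbol{e}$. Service: a single server uses the general bulk service $(a,b)$ rule. With fewer than $a$ customers in the queue the server idles until $a$ have accumulated; with $r$ customers, $a\le r\le b$, it takes them all as one batch; with more than $b$ it takes the first $b$. The service time of a batch of size $r$ ($a\le r\le b$) has probability mass function $s_r(k)$, $k\ge1$, and finite mean $S_r=\sum_{k\ge1}k\,s_r(k)=\mu_r^{-1}$. Timing (late arrival system with delayed access): slots have unit length; a potential arrival occurs in $(t-,t)$ and a potential departure in $(t,t+)$; an arrival that finds the server idle cannot depart in the slot in which it arrives. Stability is assumed: $\rho=\lambda^*/(b\mu_b)<1$. **Steady-state quantities.** Observing the system at $t-$ (just before a potential arrival) and letting $t\to\infty$: the $i$th component of $\mathbf{p}(n,0)$, $0\le n\le a-1$, is the limiting probability that the server is idle, $n$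 customers are in the queue and the arrival phase is $i$; the $i$th component of $\boldsymbol{\pi}(n,r,u)$, $n\ge0$, $a\le r\le b$, $u\ge1$, is the limiting probability that the server is busy with a batch of size $r$, $n$ customers are waiting in the queue, the phase is $i$ and the remaining service time is $u$. These limits form a probability distribution and satisfy - $\mathbf{p}(0,0)=\mathbf{p}(0,0)\mathbf{C}+\sum_{r=a}^b\boldsymbol{\pi}(0,r,1)\mathbf{C}$; - $\mathbf{p}(n,0)=\mathbf{p}(n,0)\mathbf{C}+\sum_{r=a}^b\boldsymbol{\pi}(n,r,1)\mathbf{C}+\mathbf{p}(n-1,0)\mathbf{D}+\sum_{r=a}^b\boldsymbol{\pi}(n-1,r,1)\mathbf{D}$, for $1\le n\le a-1$; - $\boldsymbol{\pi}(0,a,u)=\boldsymbol{\pi}(0,a,u+1)\mathbf{C}+\big[\mathbf{p}(a-1,0)\mathbf{D}+\sum_{r=a}^b\boldsymbol{\pi}(a,r,1)\mathbf{C}+\sum_{r=a}^b\boldsymbol{\pi}(a-1,r,1)\mathbf{D}\big]s_a(u)$; - $\boldsymbol{\pi}(0,r,u)=\boldsymbol{\pi}(0,r,u+1)\mathbf{C}+\big[\sum_{i=a}^b\boldsymbol{\pi}(r,i,1)\mathbf{C}+\sum_{i=a}^b\boldsymbol{\pi}(r-1,i,1)\mathbf{D}\big]s_r(u)$, for $a+1\le r\le b$; - $\boldsymbol{\pi}(n,r,u)=\boldsymbol{\pi}(n,r,u+1)\mathbf{C}+\boldsymbol{\pi}(n-1,r,u+1)\mathbf{D}$, for $n\ge1$,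 $a\le r\le b-1$; - $\boldsymbol{\pi}(n,b,u)=\boldsymbol{\pi}(n,b,u+1)\mathbf{C}+\boldsymbol{\pi}(n-1,b,u+1)\mathbf{D}+\big[\sum_{r=a}^b\boldsymbol{\pi}(n+b,r,1)\mathbf{C}+\sum_{r=a}^b\boldsymbol{\pi}(n+b-1,r,1)\mathbf{D}\big]s_b(u)$, for $n\ge1$, for all $u\ge1$. Departure epoch: the $j$th component of $\boldsymbol{\pi}^+(n,r)$ is the steady-state probability that, at the departure epoch of a batch, the departing batch has size $r$, there are $n$ customers in the queue and the arrival phase is $j$. With $\Omega^{-1}=\sum_{n=0}^\infty\sum_{r=a}^b\boldsymbol{\pi}(n,r,1)\boldsymbol{e}$ one has $\boldsymbol{\pi}^+(0,r)=\Omega\,\boldsymbol{\pi}(0,r,1)\mathbf{C}$ and $\boldsymbol{\pi}^+(n,r)=\Omega\big(\boldsymbol{\pi}(n,r,1)\mathbf{C}+\boldsymbol{\pi}(n-1,r,1)\mathbf{D}\big)$ for $n\ge1$, $a\le r\le b$. Put $\boldsymbol{\phi}^+(n)=\sum_{r=a}^b\boldsymbol{\pi}^+(n,r)$. Finally $\overline{\mathbf{D}}=(\mathbf{I}-\mathbf{C})^{-1}\mathbf{D}$, and for $a\le r\le b$, $|x|\le1$, $\mathbf{A}^*_r(x)=\sum_{k=1}^\infty s_r(k)(\mathbf{C}+\mathbf{D}x)^k$ (the matrix generating function of the number of arrivals during the service of a batch of size $r$). *)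

(* Defs.v *)
From HB Require Import structures.
From mathcomp Require Import all_boot all_order all_algebra.
From mathcomp Require Export complex.
From mathcomp Require Import all_classical all_reals all_analysis.

Set Implicit Arguments.
Unset Strict Implicit.
Unset Printing Implicit Defensive.

Import Order.TTheory GRing.Theory Num.Theory numFieldNormedType.Exports.

Local Open Scope classical_set_scope.
Local Open Scope ring_scope.

(* [v e], where [e] is the column vector of ones. *)
Definition mass {R : realType} {m : nat} (v : 'rV[R]_m) : R :=
  (v *m (const_mx 1 : 'cV[R]_m)) ord0 ord0.

Definition stochastic {R : realType} {m : nat} (P : 'M[R]_m) : Prop :=
  (forall i j, 0 <= P i j) /\ (forall i, \sum_j P i j = 1).

Definition irreducible_mx {R : realType} {m : nat} (P : 'M[R]_m) : Prop :=
  forall i j, exists k : nat, 0 < (P ^+ k) i j.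

Record is_dmap {R : realType} {m : nat} (C D : 'M[R]_m) : Prop := IsDMAP {
  dmap_C_ge0 : forall i j, 0 <= C i j;
  dmap_D_ge0 : forall i j, 0 <= D i j;
  dmap_C_pos : exists i j, 0 < C i j;
  dmap_D_pos : exists i j, 0 < D i j;
  dmap_stochastic : stochastic (C + D);
  dmap_irreducible : irreducible_mx (C + D)
}.

Record is_stationary {R : realType} {m : nat} (P : 'M[R]_m) (v : 'rV[R]_m) :
    Prop := IsStationary {
  stationary_ge0 : forall j, 0 <= v ord0 j;
  stationary_mass : mass v = 1;
  stationary_eq : v *m P = v
}.

(* Expectation of the law [s] on {1, 2, ...}; the value [s 0] is never used. *)
Definition service_mean_ereal {R : realType} (s : nat -> R) : \bar R :=
  (\sum_(1 <= k <oo) (k%:R * s k)%:E)%E.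

Definition service_mean {R : realType} (s : nat -> R) : R :=
  fine (service_mean_ereal s).

Record is_service_law {R : realType} (s : nat -> R) : Prop := IsServiceLaw {
  service_ge0 : forall k, (1 <= k)%N -> 0 <= s k;
  service_total : (\sum_(1 <= k <oo) (s k)%:E = 1)%E;
  service_mean_fin : (service_mean_ereal s < +oo)%E
}.

Definition service_rate {R : realType} (s : nat -> R) : R :=
  (service_mean s)^-1.

Definition traffic_intensity {R : realType} {m : nat} (b : nat) (D : 'M[R]_m)
    (s : nat -> nat -> R) (pibar : 'rV[R]_m) : R :=
  mass (pibar *m D) / (b%:R * service_rate (s b)).

(* [pidle n] is p(n,0), meaningful for n <= a-1; [pbusy n r u] is pi(n,r,u),
   meaningful for a <= r <= b and u >= 1.  Values outside these ranges are
   unconstrained and never used.  The equations relate the law of the system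
   just before two consecutive potential arrivals; each involves finitely many
   states, so they hold for the limits of the transient probabilities. *)
Record steady_state {R : realType} {m : nat} (a b : nat) (C D : 'M[R]_m)
    (s : nat -> nat -> R)
    (pidle : nat -> 'rV[R]_m) (pbusy : nat -> nat -> nat -> 'rV[R]_m) :
    Prop := SteadyState {
  idle_ge0 : forall n j, (n < a)%N -> 0 <= pidle n ord0 j;
  busy_ge0 : forall n r u j, (a <= r <= b)%N -> (1 <= u)%N ->
    0 <= pbusy n r u ord0 j;
  total_mass :
    ((\sum_(0 <= n < a) mass (pidle n))%:E +
     \sum_(0 <= n <oo) \sum_(1 <= u <oo)
       (\sum_(a <= r < b.+1) mass (pbusy n r u))%:E = 1)%E;
  idle_0 :
    pidle 0%N = pidle 0%N *m C + \sum_(a <= r < b.+1) pbusy 0%N r 1%N *m C;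
  idle_n : forall n, (1 <= n <= a.-1)%N ->
    pidle n = pidle n *m C + \sum_(a <= r < b.+1) pbusy n r 1%N *m C
            + pidle n.-1 *m D + \sum_(a <= r < b.+1) pbusy n.-1 r 1%N *m D;
  busy_0_a : forall u, (1 <= u)%N ->
    pbusy 0%N a u = pbusy 0%N a u.+1 *m C
      + s a u *: (pidle a.-1 *m D
                  + \sum_(a <= r < b.+1) pbusy a r 1%N *m C
                  + \sum_(a <= r < b.+1) pbusy a.-1 r 1%N *m D);
  busy_0_r : forall r u, (a.+1 <= r <= b)%N -> (1 <= u)%N ->
    pbusy 0%N r u = pbusy 0%N r u.+1 *m C
      + s r u *: (\sum_(a <= i < b.+1) pbusy r i 1%N *m C
                  + \sum_(a <= i < b.+1) pbusy r.-1 i 1%N *m D);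
  busy_n_r : forall n r u, (1 <= n)%N -> (a <= r < b)%N -> (1 <= u)%N ->
    pbusy n r u = pbusy n r u.+1 *m C + pbusy n.-1 r u.+1 *m D;
  busy_n_b : forall n u, (1 <= n)%N -> (1 <= u)%N ->
    pbusy n b u = pbusy n b u.+1 *m C + pbusy n.-1 b u.+1 *m D
      + s b u *: (\sum_(a <= r < b.+1) pbusy (n + b)%N r 1%N *m C
                  + \sum_(a <= r < b.+1) pbusy (n + b).-1 r 1%N *m D)
}.

(* Omega is the inverse of the stationary probability that a service ends in
   a given slot. *)
Definition Omega {R : realType} {m : nat} (a b : nat)
    (pbusy : nat -> nat -> nat -> 'rV[R]_m) : R :=
  (fine (\sum_(0 <= n <oo)
           (\sum_(a <= r < b.+1) mass (pbusy n r 1%N))%:E)%E)^-1.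

(* pi^+(n,r) *)
Definition departure {R : realType} {m : nat} (a b : nat) (C D : 'M[R]_m)
    (pbusy : nat -> nat -> nat -> 'rV[R]_m) (n r : nat) : 'rV[R]_m :=
  Omega a b pbusy *:
    (if n is n'.+1 then pbusy n r 1%N *m C + pbusy n' r 1%N *m D
     else pbusy 0%N r 1%N *m C).

(* phi^+(n) *)
Definition departure_queue {R : realType} {m : nat} (a b : nat)
    (C D : 'M[R]_m) (pbusy : nat -> nat -> nat -> 'rV[R]_m) (n : nat) :
    'rV[R]_m :=
  \sum_(a <= r < b.+1) departure a b C D pbusy n r.

Definition Dbar {R : realType} {m : nat} (C D : 'M[R]_m) : 'M[R]_m :=
  invmx (1%:M - C) *m D.

Definition cmx {R : realType} {m n : nat} (M : 'M[R]_(m, n)) :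
    'M[R[i]]_(m, n) :=
  map_mx (real_complex R) M.

(* Entrywise limit.  The regular algebra [R[i]^o] carries the usual topology
   of the complex numbers. *)
Definition mxlim {R : realType} {m n : nat} (u : nat -> 'M[R[i]]_(m, n)) :
    'M[R[i]]_(m, n) :=
  \matrix_(i, j) (limn (fun N => u N i j : (R[i])^o)).

(* A^*(x), for the service law [s]; the series converges for |x| <= 1. *)
Definition Astar {R : realType} {m : nat} (C D : 'M[R]_m) (s : nat -> R)
    (x : R[i]) : 'M[R[i]]_m :=
  mxlim (fun N =>
    \sum_(1 <= k < N) real_complex R (s k) *: (cmx C + x *: cmx D) ^+ k).

(* The bivariate vector generating function of pi^+; the series over n
   converges for |x| <= 1. *)
Definition departure_gf {R : realType} {m : nat} (a b : nat) (C D : 'M[R]_m)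
    (pbusy : nat -> nat -> nat -> 'rV[R]_m) (x xi : R[i]) : 'rV[R[i]]_m :=
  mxlim (fun N =>
    \sum_(0 <= n < N) \sum_(a <= r < b.+1)
      (x ^+ n * xi ^+ r) *: cmx (departure a b C D pbusy n r)).

(* Main.v *)
Require Import Defs.
From HB Require Import structures.
From mathcomp Require Import all_boot all_order all_algebra complex.
From mathcomp Require Import ring.
From mathcomp Require Import all_classical all_reals all_analysis.
Import Order.TTheory GRing.Theory Num.Theory numFieldNormedType.Exports.
Local Open Scope ring_scope.

(** Fix a batch size [r].  Truncating the balance equations at queue lengths
[n < N] and unrolling them over the remaining service time [u = 1, ..., K]
writes the truncated departure series as
[start_N *m \sum_(k <= K) s_r(k) (C + x D)^k] plus a term that vanishes as
[K -> oo] plus boundary terms at queue length [N - 1].  Since [C + x D] is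
row-substochastic, the boundary terms are bounded by the stationary mass of
queue length [N - 1], which tends to [0].  Hence the departure series of size
[r] and [start_N *m A_r] have the same limit, and for [r < b] the start series
is a single vector.  For [r = b] the start series times [x^b] is a shift of the
full departure series, so the truncated series times [x^b - A_b] converges, and
invertibility of [x^b - A_b] gives the convergence of the series itself.  The
idle probabilities are eliminated by [p(n) D = (phi(n) + p(n-1) D) Dbar].
All relations are homogeneous in [Omega]. *)

(** * Entrywise limits of complex matrices *)

(** [mxlim] yields a value even when no limit exists, so convergence is carried by a separate
    relation with an explicit limit. *)
Definition mxcvg {R : realType} {m n : nat} (u : nat -> 'M[R[i]]_(m, n))
    (L : 'M[R[i]]_(m, n)) : Prop :=
  forall i j, ((fun N => u N i j : (R[i])^o) @ \oo --> (L i j : (R[i])^o))%classic.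

Section MatrixLimits.
Context {R : realType}.
Implicit Types (m n p : nat).

Lemma mxcvg_mxlim {m n} (u : nat -> 'M[R[i]]_(m, n)) L :
  mxcvg u L -> mxlim u = L.
Proof.
move=> uL; apply/matrixP => i j; rewrite mxE.
by apply: (@cvg_lim ((R[i])^o)); [exact: norm_hausdorff | exact: uL].
Qed.

Lemma eq_mxcvg {m n} (u v : nat -> 'M[R[i]]_(m, n)) L :
  u =1 v -> mxcvg u L -> mxcvg v L.
Proof. by move=> /funext ->. Qed.

Lemma mxcvg_cst {m n} (L : 'M[R[i]]_(m, n)) : mxcvg (fun=> L) L.
Proof. by move=> i j; apply: cvg_cst. Qed.

Lemma mxcvgD {m n} (u v : nat -> 'M[R[i]]_(m, n)) L L' :
  mxcvg u L -> mxcvg v L' -> mxcvg (fun N => u N + v N) (L + L').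
Proof.
move=> uL vL i j; rewrite mxE; under eq_fun do rewrite mxE.
exact: (cvgD (uL i j) (vL i j)).
Qed.

Lemma cvg_sumC {I : Type} (r : seq I) (P : pred I)
    (u : I -> nat -> R[i]) (l : I -> R[i]) :
  (forall k, P k -> (u k N : (R[i])^o) @[N --> \oo] --> (l k : (R[i])^o))%classic ->
  ((\sum_(k <- r | P k) u k N : (R[i])^o) @[N --> \oo] -->
    (\sum_(k <- r | P k) l k : (R[i])^o))%classic.
Proof. by move=> ul; apply: cvg_big => //; exact: add_continuous. Qed.

Lemma mxcvg_sum {m n} {I : Type} (r : seq I) (P : pred I)
    (u : I -> nat -> 'M[R[i]]_(m, n)) (L : I -> 'M[R[i]]_(m, n)) :
  (forall k, P k -> mxcvg (u k) (L k)) ->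
  mxcvg (fun N => \sum_(k <- r | P k) u k N) (\sum_(k <- r | P k) L k).
Proof.
move=> uL i j; rewrite summxE; under eq_fun do rewrite summxE.
by apply: cvg_sumC => k /uL.
Qed.

Lemma mxcvg_sum_nat {m n} (l h : nat) (u : nat -> nat -> 'M[R[i]]_(m, n))
    (L : nat -> 'M[R[i]]_(m, n)) :
  (forall k, (l <= k < h)%N -> mxcvg (u k) (L k)) ->
  mxcvg (fun N => \sum_(l <= k < h) u k N) (\sum_(l <= k < h) L k).
Proof.
move=> uL; rewrite [X in mxcvg _ X]big_nat_cond.
apply: (eq_mxcvg (fun N => \sum_(l <= k < h | (l <= k < h)%N && true) u k N)) => [N|].
  by rewrite -big_nat_cond.
by apply: mxcvg_sum => k; rewrite andbT; exact: uL.
Qed.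

Lemma mxcvgZ {m n} c (u : nat -> 'M[R[i]]_(m, n)) L :
  mxcvg u L -> mxcvg (fun N => c *: u N) (c *: L).
Proof.
move=> uL i j; rewrite mxE; under eq_fun do rewrite mxE.
exact: (cvgMl_tmp (uL i j)).
Qed.

Lemma mxcvgN {m n} (u : nat -> 'M[R[i]]_(m, n)) L :
  mxcvg u L -> mxcvg (fun N => - u N) (- L).
Proof.
move=> /(mxcvgZ (-1)); rewrite scaleN1r.
by apply: eq_mxcvg => N; rewrite scaleN1r.
Qed.

Lemma mxcvgB {m n} (u v : nat -> 'M[R[i]]_(m, n)) L L' :
  mxcvg u L -> mxcvg v L' -> mxcvg (fun N => u N - v N) (L - L').
Proof. by move=> uL /mxcvgN vL; apply: mxcvgD. Qed.

Lemma mxcvgMr {m n p} (B : 'M[R[i]]_(n, p)) (u : nat -> 'M[R[i]]_(m, n)) L :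
  mxcvg u L -> mxcvg (fun N => u N *m B) (L *m B).
Proof.
move=> uL i j; rewrite mxE; under eq_fun do rewrite mxE.
by apply: cvg_sumC => k _; exact: (cvgMr_tmp (uL i k)).
Qed.

Lemma mxcvgMl {m n p} (B : 'M[R[i]]_(m, n)) (u : nat -> 'M[R[i]]_(n, p)) L :
  mxcvg u L -> mxcvg (fun N => B *m u N) (B *m L).
Proof.
move=> uL i j; rewrite mxE; under eq_fun do rewrite mxE.
by apply: cvg_sumC => k _; exact: (cvgMl_tmp (uL k j)).
Qed.

Lemma mxcvg_shift {m n} k (u : nat -> 'M[R[i]]_(m, n)) L :
  mxcvg (fun N => u (N + k)%N) L <-> mxcvg u L.
Proof.
split=> uL i j; have := uL i j; first by rewrite (cvg_shiftn k (fun N => u N i j : (R[i])^o)).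
by rewrite -(cvg_shiftn k (fun N => u N i j : (R[i])^o)).
Qed.

(** * Norm bounds and dominated series in [R[i]] *)

Lemma normcR (y : R) : `|y%:C%C| = `|y|%:C%C.
Proof. by rewrite normc_def /= expr0n addr0 sqrtr_sqr. Qed.

Lemma normc_leD (y z : R) : `|(y +i* z)%C| <= (`|y| + `|z|)%:C%C.
Proof.
rewrite normc_def lecR /= -(ler_pXn2r (ltn0Sn 1)) ?nnegrE ?sqrtr_ge0 ?addr_ge0//.
rewrite sqr_sqrtr ?addr_ge0 ?sqr_ge0// sqrrD !real_normK ?num_real// -addrA.
by rewrite lerD2l lerDr mulrn_wge0// mulr_ge0.
Qed.

Lemma cvg0_le_norm (u : nat -> R[i]) (t : nat -> R) :
  (forall N, `|u N| <= (t N)%:C%C) -> (t @ \oo --> (0 : R))%classic ->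
  ((u N : (R[i])^o) @[N --> \oo] --> (0 : (R[i])^o))%classic.
Proof.
move=> ut t0; apply/cvgr0Pnorm_lt => e e0.
(* In the order of [R[i]] a positive element has zero imaginary part, so the tolerance [e] is
   real. *)
have eE : e = (complex.Re e)%:C%C.
  by move: e0; case: e => re ie; rewrite ltcE /= => /andP[/eqP ->].
have re0 : 0 < complex.Re e by rewrite -ltcR -eE.
move/cvgr0Pnorm_lt: t0 => /(_ _ re0); apply: filterS => N tN.
rewrite (le_lt_trans (ut N))// eE ltcR.
exact: le_lt_trans (ler_norm _) tN.
Qed.

Lemma norm_cvg_le (u : nat -> R[i]) (l B : R[i]) :
  (forall N, `|u N| <= B) ->
  ((u N : (R[i])^o) @[N --> \oo] --> (l : (R[i])^o))%classic -> `|l| <= B.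
Proof.
move=> uB ul; apply/ler_addgt0Pr => e e0.
move/cvgrPdist_lt: ul => /(_ _ e0) [N _ /(_ N (leqnn N)) /= lN].
rewrite -[l](subrK (u N)) addrC (le_trans (ler_normD _ _))//.
by rewrite lerD// ltW.
Qed.

(** Comparison with [t] makes the real and imaginary parts absolutely convergent; the limit is
    assembled from the two real limits. *)
Lemma is_cvg_complex_series (c : nat -> R[i]) (t : nat -> R) :
  (forall k, `|c k| <= (t k)%:C%C) -> cvgn (series t) ->
  exists l : R[i],
    ((\sum_(0 <= k < N) c k : (R[i])^o) @[N --> \oo] --> (l : (R[i])^o))%classic.
Proof.
move=> ct cvt.
have cvn (f : nat -> R) : (forall k, `|f k| <= t k) -> cvgn (series f).
  move=> ft; apply: normed_cvg; apply: series_le_cvg cvt => //= k.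
  exact: le_trans (ft k).
have Re_cvg : cvgn (series (fun k => complex.Re (c k))).
  by apply: cvn => k; rewrite -lecR (le_trans _ (ct k))// normc_ge_Re.
have Im_cvg : cvgn (series (fun k => complex.Im (c k))).
  apply: cvn => k; rewrite -lecR (le_trans _ (ct k))//.
  rewrite normc_def lecR -sqrtr_sqr ler_wsqrtr// lerDr sqr_ge0//.
set f := series (fun k => complex.Re (c k)) in Re_cvg.
set g := series (fun k => complex.Im (c k)) in Im_cvg.
exists (limn f +i* limn g)%C; apply/cvgrPdist_lt => e e0.
have eE : e = (complex.Re e)%:C%C.
  by move: e0; case: e => re ie; rewrite ltcE /= => /andP[/eqP ->].
have re0 : 0 < complex.Re e / 2 by rewrite divr_gt0// -ltcR -eE.
have /cvgrPdist_lt/(_ _ re0) fl := Re_cvg.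
have /cvgrPdist_lt/(_ _ re0) gl := Im_cvg.
near=> N.
have -> : \sum_(0 <= k < N) c k = (f N +i* g N)%C.
  rewrite /f /g /series /=; elim: (N) => [|K IHK]; first by rewrite !big_geq.
  by rewrite !big_nat_recr//= IHK [c K in LHS]complexE; simpc.
have -> : (limn f +i* limn g)%C - (f N +i* g N)%C =
    ((limn f - f N) +i* (limn g - g N))%C by simpc.
rewrite (le_lt_trans (normc_leD _ _))// eE ltcR [ltRHS]splitr ltrD//.
  by near: N; exact: fl.
by near: N; exact: gl.
Unshelve. all: by end_near.
Qed.

End MatrixLimits.

(** * Passage from real to complex matrices *)

Section RealComplexMatrix.
Context {R : realType}.

Lemma cmxM {k l q} (A : 'M[R]_(k, l)) (B : 'M[R]_(l, q)) :
  cmx (A *m B) = cmx A *m cmx B.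
Proof. exact: map_mxM. Qed.

Lemma cmxD {k l} (A B : 'M[R]_(k, l)) : cmx (A + B) = cmx A + cmx B.
Proof. exact: map_mxD. Qed.

Lemma cmxZ {k l} c (A : 'M[R]_(k, l)) : cmx (c *: A) = c%:C%C *: cmx A.
Proof. exact: map_mxZ. Qed.

Lemma cmx0 {k l} : cmx (0 : 'M[R]_(k, l)) = 0.
Proof. exact: map_mx0. Qed.

Lemma cmx_sum {I : Type} {k l} (r : seq I) (P : pred I) (G : I -> 'M[R]_(k, l)) :
  cmx (\sum_(i <- r | P i) G i) = \sum_(i <- r | P i) cmx (G i).
Proof. exact: raddf_sum. Qed.

End RealComplexMatrix.

Lemma is_cvg_nneg_series_bounded {R : realType} (t : nat -> R) B :
  (forall k, 0 <= t k) -> (forall K, \sum_(0 <= k < K) t k <= B) ->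
  cvgn (series t).
Proof.
move=> t0 tB; apply: nondecreasing_is_cvgn; last by exists B => _ [K _ <-]; exact: tB.
by apply: nondecreasing_series => k _ _; exact: t0.
Qed.

(** * The l1 norm of row vectors and matrices with absolute row sums at most 1 *)

Section MatrixNorm.
Context {R : realType} {m : nat}.
Implicit Types (v : 'rV[R[i]]_m) (M : 'M[R[i]]_m).

(** Valued in [R[i]] so as to compare directly with moduli of entries. *)
Definition l1norm v : R[i] := \sum_j `|v ord0 j|.

Lemma norm_le_l1norm v j : `|v ord0 j| <= l1norm v.
Proof. by rewrite /l1norm (bigD1 j)//= lerDl sumr_ge0. Qed.

Lemma l1normD v w : l1norm (v + w) <= l1norm v + l1norm w.
Proof. by rewrite -big_split; apply: ler_sum => j _; rewrite mxE ler_normD. Qed.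

Lemma l1normZ c v : l1norm (c *: v) = `|c| * l1norm v.
Proof. by rewrite mulr_sumr; apply: eq_bigr => j _; rewrite mxE normrM. Qed.

Lemma l1norm_sum {I : Type} (r : seq I) (P : pred I) (F : I -> 'rV[R[i]]_m) :
  l1norm (\sum_(i <- r | P i) F i) <= \sum_(i <- r | P i) l1norm (F i).
Proof.
elim/big_ind2: _ => //.
  by rewrite /l1norm big1// => j _; rewrite mxE normr0.
by move=> u B v B' uB vB'; rewrite (le_trans (l1normD _ _))// lerD.
Qed.

Lemma l1normM v M : (forall i, \sum_j `|M i j| <= 1) -> l1norm (v *m M) <= l1norm v.
Proof.
move=> M1; apply: (@le_trans _ _ (\sum_j \sum_i `|v ord0 i| * `|M i j|)).
  apply: ler_sum => j _; rewrite mxE (le_trans (ler_norm_sum _ _ _))//.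
  by apply: ler_sum => i _; rewrite normrM.
rewrite exchange_big; apply: ler_sum => i _ /=.
by rewrite -mulr_sumr ler_piMr.
Qed.

Lemma l1normMX v M k :
  (forall i, \sum_j `|M i j| <= 1) -> l1norm (v *m M ^+ k) <= l1norm v.
Proof.
move=> M1; elim: k => [|k IHk]; first by rewrite expr0 mulmx1.
by rewrite exprSr mulmxA (le_trans (l1normM _ _ M1)).
Qed.

(** Row [i] of [M ^+ k] is the image of a unit row vector, whose l1 norm is 1. *)
Lemma norm_expmx_le1 M k i j : (forall i, \sum_j `|M i j| <= 1) -> `|(M ^+ k) i j| <= 1.
Proof.
move=> M1; have -> : (M ^+ k) i j = ((delta_mx ord0 i : 'rV_m) *m M ^+ k) ord0 j.
  by rewrite -rowE mxE.
rewrite (le_trans (norm_le_l1norm _ _))// (le_trans (l1normMX _ _ _ M1))//.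
rewrite /l1norm (bigD1 i)//= big1 => [|l li].
  by rewrite mxE !eqxx normr1 addr0.
by rewrite mxE eqxx (negbTE li) normr0.
Qed.

Lemma mxcvg0_l1norm (u v : nat -> 'rV[R[i]]_m) :
  (forall N, l1norm (v N) <= l1norm (u N)) -> mxcvg u 0 -> mxcvg v 0.
Proof.
move=> vu u0 i j; rewrite ord1 mxE; apply/cvgr0Pnorm_lt => e e0.
have : ((\sum_k `|u N ord0 k| : (R[i])^o) @[N --> \oo] --> (\sum_(k < m) 0 : (R[i])^o))%classic.
  apply: cvg_sumC => k _; apply/cvgr0Pnorm_lt => e' e'0.
  have := u0 ord0 k; rewrite mxE => /cvgr0Pnorm_lt/(_ _ e'0).
  by apply: filterS => N; rewrite normr_id.
rewrite big1// => /cvgr0Pnorm_lt/(_ _ e0); apply: filterS => N.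
rewrite ger0_norm ?sumr_ge0//; apply: le_lt_trans.
exact: le_trans (norm_le_l1norm _ _) (vu N).
Qed.

End MatrixNorm.

(** * Generating function of the outflow of one batch size *)

Section Service.
Context {R : realType} {m : nat}.
Variables (C D : 'M[R]_m) (x : R[i]).
Hypothesis HCD : is_dmap C D.
Hypothesis x_le1 : `|x| <= 1.

Let M : 'M[R[i]]_m := cmx C + x *: cmx D.

Let C0 := dmap_C_ge0 HCD.
Let D0 := dmap_D_ge0 HCD.
Let CD1 := (dmap_stochastic HCD).2.

Lemma dmap_norm_gf i : \sum_j `|M i j| <= 1.
Proof.
rewrite (_ : 1 = (\sum_j (C + D) i j)%:C%C); last by rewrite CD1.
rewrite rmorph_sum; apply: ler_sum => j _ /=.
rewrite !mxE (le_trans (ler_normD _ _))// rmorphD lerD//=.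
  by rewrite normcR ger0_norm.
by rewrite normrM normcR (ger0_norm (D0 _ _)) ler_piMl// lecR.
Qed.

Lemma dmap_norm_D i : \sum_j `|cmx D i j| <= 1.
Proof.
rewrite (_ : 1 = (\sum_j (C + D) i j)%:C%C); last by rewrite CD1.
rewrite rmorph_sum; apply: ler_sum => j _ /=.
by rewrite !mxE normcR (ger0_norm (D0 _ _)) lecR lerDr.
Qed.

Lemma service_partial_le1 (s : nat -> R) K :
  is_service_law s -> \sum_(1 <= k < K) s k <= 1.
Proof.
case=> s0 s1 _; rewrite -lee_fin -s1 -sumEFin.
by apply: nneseries_lim_ge => k k1 _; rewrite lee_fin s0.
Qed.

(** Powers of [M] have entries of modulus at most 1, so the series is dominated by the service law,
    whose total is 1. *)
Lemma Astar_cvg (s : nat -> R) : is_service_law s ->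
  mxcvg (fun N => \sum_(1 <= k < N) real_complex R (s k) *: M ^+ k)
    (Astar C D s x).
Proof.
move=> Hs i j; rewrite /Astar mxE -/M.
set f := fun N : nat => _.
suff [l fl] : exists l : R[i], ((f N : (R[i])^o) @[N --> \oo] --> (l : (R[i])^o))%classic.
  by have /(@cvg_lim ((R[i])^o) (@norm_hausdorff _ _)) -> := fl.
(* [s 0] is unconstrained, so index 0 is set to zero; the partial sums starting at 1 are
   unaffected. *)
pose t k := if k == 0%N then 0 else s k.
have t0 k : 0 <= t k by rewrite /t; case: eqP => // /eqP; rewrite -lt0n; exact: service_ge0 Hs k.
have [||l hl] := is_cvg_complex_series (fun k => ((t k)%:C%C *: M ^+ k) i j) t.
- move=> k; rewrite mxE normrM normcR (ger0_norm (t0 k)).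
  by apply: ler_piMr; [rewrite (lecR 0) | apply: norm_expmx_le1; exact: dmap_norm_gf].
- apply: (is_cvg_nneg_series_bounded t 1 t0) => -[|K]; first by rewrite big_geq.
  rewrite big_nat_recl// add0r; have := service_partial_le1 s K.+1 Hs.
  by rewrite big_add1.
exists l; rewrite -cvg_shiftS; rewrite -cvg_shiftS in hl.
apply: cvg_trans hl; apply: near_eq_cvg; near=> N.
rewrite /= /f /t. rewrite summxE big_nat_recl//= scale0r mxE add0r big_add1 /=.
by apply: eq_bigr => k _.
Unshelve. all: by end_near.
Qed.

(** * Unrolling the balance equations of one batch size over the remaining service time *)

Section Flow.
Variables (s : nat -> R) (p : nat -> nat -> 'rV[R]_m) (st : nat -> 'rV[R]_m).
Variable T : nat -> R.
Hypothesis Hs : is_service_law s.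

(** One slot of the arrival process: queue length [n] is reached from [n] without an arrival or from
    [n - 1] with one. At [u = 1] this gives the departure vectors. *)
Definition outflow (n u : nat) : 'rV[R]_m :=
  p n u *m C + (if n is n'.+1 then p n' u *m D else 0).

Hypothesis p_rec : forall n u, (1 <= u)%N ->
  p n u = outflow n u.+1 + s u *: st n.
Hypothesis T_cvg0 : (T @ \oo --> (0 : R))%classic.
Hypothesis p_le_T : forall n K,
  \sum_(1 <= u < K) l1norm (cmx (p n u)) <= (T n)%:C%C.

Let flow N u : 'rV[R[i]]_m := \sum_(0 <= n < N) x ^+ n *: cmx (outflow n u).
Let start N : 'rV[R[i]]_m := \sum_(0 <= n < N) x ^+ n *: cmx (st n).
(** Weight lost by truncation: an arrival at queue length [N] leads to [N + 1], beyond the terms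
    kept. *)
Let edge N u : 'rV[R[i]]_m := x ^+ N.+1 *: cmx (p N u *m D).

Lemma flow_truncated N u :
  flow N.+1 u = (\sum_(0 <= n < N.+1) x ^+ n *: cmx (p n u)) *m M - edge N u.
Proof.
rewrite /flow /edge; elim: N => [|N IHN].
  rewrite !big_nat1 !expr0 !scale1r /outflow addr0 !cmxM mulmxDr -scalemxAr expr1.
  by rewrite addrK.
rewrite big_nat_recr//= IHN [in RHS]big_nat_recr//= mulmxDl -!addrA; congr (_ + _).
rewrite cmxD !cmxM mulmxDr -!scalemxAl -!scalemxAr scalerDr !scalerA -exprSr.
by rewrite addrK addrC addrK.
Qed.

Lemma truncated_rec N u : (1 <= u)%N ->
  \sum_(0 <= n < N) x ^+ n *: cmx (p n u) = flow N u.+1 + (s u)%:C%C *: start N.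
Proof.
move=> u1; rewrite scaler_sumr -big_split; apply: eq_bigr => n _ /=.
by rewrite p_rec// cmxD cmxZ scalerDr !scalerA [_%:C%C * _]mulrC.
Qed.

(** By induction on [K]: [flow_truncated] brings out a factor [M] and one edge term, then
    [truncated_rec] releases the batch starts with service time [K + 1]. *)
Lemma flow_unroll N K :
  flow N.+1 1 = start N.+1 *m (\sum_(1 <= k < K.+1) real_complex R (s k) *: M ^+ k)
    + flow N.+1 K.+1 *m M ^+ K - \sum_(0 <= u < K) edge N u.+1 *m M ^+ u.
Proof.
elim: K => [|K IHK].
  by rewrite !big_geq// expr0 mulmx1 mulmx0 subr0 add0r.
rewrite IHK (flow_truncated N K.+1) truncated_rec// [in RHS]big_nat_recr//=.

rewrite [X in _ = _ - X]big_nat_recr//= mulmxBl !mulmxDl (mulmxDr (start _)).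
have MX : M *m M ^+ K = M ^+ K.+1 by rewrite exprS.
rewrite -!scalemxAl -!scalemxAr -!mulmxA MX opprD !addrA .
rewrite [RHS]addrAC; congr (_ - _ - _); exact: addrAC.
Qed.

(** For fixed [n] the norms are summable over [u >= 1], their partial sums being bounded by
    [T n]. *)
Lemma p_cvg0 n : mxcvg (fun u => cmx (p n u)) 0.
Proof.
pose t u := if u == 0%N then 0 else \sum_j `|p n u ord0 j|.
have tE u : (1 <= u)%N -> l1norm (cmx (p n u)) = (t u)%:C%C.
  case: u => // u _; rewrite /t /= rmorph_sum; apply: eq_bigr => j _.
  by rewrite mxE normcR.
have t0 u : 0 <= t u by rewrite /t; case: eqP => // _; rewrite sumr_ge0.
have /cvg_series_cvg_0 tcvg : cvgn (series t).
  apply: (is_cvg_nneg_series_bounded t (T n) t0) => -[|K].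
    by rewrite big_geq// -lecR (le_trans _ (p_le_T n 0))// big_geq.
  rewrite big_nat_recl// add0r -lecR (le_trans _ (p_le_T n K.+1))//.
  rewrite rmorph_sum big_add1 /=.
  by apply: ler_sum => u _; rewrite tE.
apply/(mxcvg_shift 1) => i j; rewrite ord1 mxE.
apply: (cvg0_le_norm _ (fun u => t (u + 1)%N)).
  by move=> u; rewrite -tE ?addn1// norm_le_l1norm.
by rewrite (cvg_shiftn 1 t).
Qed.

Lemma outflow_cvg0 n : mxcvg (fun u => cmx (outflow n u)) 0.
Proof.
have := mxcvgMr (cmx C) _ _ (p_cvg0 n); rewrite mul0mx => pC.
case: n pC => [|n] pC.
  by apply: eq_mxcvg pC => u; rewrite /outflow addr0 cmxM.
have := mxcvgMr (cmx D) _ _ (p_cvg0 n); rewrite mul0mx => /(mxcvgD _ _ _ _ pC).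
by rewrite addr0; apply: eq_mxcvg => u; rewrite /outflow cmxD !cmxM.
Qed.

(** With [N] fixed and [K] tending to infinity in [flow_unroll], the error consists of the edge
    terms alone, whose total norm is at most [T N] for every [K]. *)
Lemma flow_approx N j :
  `|(flow N.+1 1 - start N.+1 *m Astar C D s x) ord0 j| <= (T N)%:C%C.
Proof.
pose E K := \sum_(0 <= u < K) edge N u.+1 *m M ^+ u.
have tail0 : mxcvg (fun K => flow N.+1 K.+1 *m M ^+ K) 0.
  apply: (mxcvg0_l1norm (fun K => flow N.+1 K.+1)).
    by move=> K; apply: l1normMX; exact: dmap_norm_gf.
  apply: (eq_mxcvg (fun K => flow N.+1 (K + 1)%N)) => [K|]; first by rewrite addn1.
  apply/(mxcvg_shift 1 (flow N.+1)).
  have -> : (0 : 'rV[R[i]]_m) = \sum_(0 <= n < N.+1) x ^+ n *: 0.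
    by rewrite big1// => n _; rewrite scaler0.
  by apply: mxcvg_sum => n _; apply: mxcvgZ; exact: outflow_cvg0.
have Ecvg : mxcvg E (start N.+1 *m Astar C D s x + 0 - flow N.+1 1).
  have /(mxcvgMl (start N.+1)) Acvg := (mxcvg_shift 1 _ _).2 (Astar_cvg s Hs).
  have := mxcvgB _ _ _ _ (mxcvgD _ _ _ _ Acvg tail0) (mxcvg_cst (flow N.+1 1)).
  apply: eq_mxcvg => K; rewrite [X in _ - X = _](flow_unroll N K) addn1.
  by rewrite opprB addrC addrNK.
have -> : `|(flow N.+1 1 - start N.+1 *m Astar C D s x) ord0 j|
    = `|(start N.+1 *m Astar C D s x + 0 - flow N.+1 1) ord0 j|.
  by rewrite addr0 -opprB [X in `|X| = _]mxE normrN.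
apply: norm_cvg_le (Ecvg ord0 j) => K.
rewrite (le_trans (norm_le_l1norm _ _))// (le_trans (l1norm_sum _ _ _))//.
(* Each edge term is at most [l1norm (cmx (p N u.+1))], since [|x| <= 1] and neither [D] nor [M]
   increases the l1 norm. *)
apply: le_trans (p_le_T N K.+1); rewrite big_add1 /=; apply: ler_sum => u _.
rewrite (le_trans (l1normMX _ _ _ dmap_norm_gf))// l1normZ cmxM.
rewrite normrX (le_trans (ler_piMl _ _)) ?exprn_ile1//.
  by rewrite /l1norm sumr_ge0.
exact: l1normM dmap_norm_D.
Qed.

(** Only the difference is controlled: for [r = b] the convergence of the two series is not yet
    known. *)
Lemma outflow_gf_cvg :
  mxcvg (fun N => \sum_(0 <= n < N) x ^+ n *: cmx (outflow n 1) -
    (\sum_(0 <= n < N) x ^+ n *: cmx (st n)) *m Astar C D s x) 0.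
Proof.
apply/(mxcvg_shift 1) => i j; rewrite ord1 mxE.
by apply: (cvg0_le_norm _ T) => // N; rewrite addn1; exact: flow_approx.
Qed.

End Flow.
End Service.

(* If [v *m C = v], then [|v|] is invariant under the irreducible [C + D] and
   annihilated by [D]. *)
Lemma dmap_unitmx {R : realType} {m : nat} (C D : 'M[R]_m) :
  is_dmap C D -> 1%:M - C \in unitmx.
Proof.
case=> C0 D0 _ [i0 [j0 Dij]] [_ P1] irr.
rewrite -row_free_unit -kermx_eq0; apply/negPn/negP => /rowV0Pn[v /sub_kermxP vC v0].
have {}vC : v = v *m C by apply/eqP; rewrite -subr_eq0 -[X in X - _]mulmx1 -mulmxBr vC.
pose w : 'rV[R]_m := \row_j `|v ord0 j|.
have w0 j : 0 <= w ord0 j by rewrite mxE.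
have wD0 j : 0 <= (w *m D) ord0 j by rewrite mxE sumr_ge0// => i _; rewrite mulr_ge0.
(* [|v| = |v C|] is at most [|v| C] entrywise. *)
have wC0 j : 0 <= (w *m C) ord0 j - w ord0 j.
  rewrite subr_ge0 [leLHS]mxE {1}vC !mxE (le_trans (ler_norm_sum _ _ _))//.
  by apply: ler_sum => i _; rewrite normrM mxE (ger0_norm (C0 _ _)).
(* [C + D] preserves total mass, so these nonnegative terms sum to zero and each of them
   vanishes. *)
have tot : \sum_j ((w *m C) ord0 j - w ord0 j + (w *m D) ord0 j) = 0.
  transitivity (\sum_j (w *m (C + D)) ord0 j - \sum_j w ord0 j).
    rewrite -sumrB; apply: eq_bigr => j _.
    by rewrite mulmxDr [X in _ = X - _]mxE addrAC.
  apply/eqP; rewrite subr_eq0; apply/eqP.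
  under eq_bigr do rewrite mxE.
  rewrite exchange_big; apply: eq_bigr => i _ /=.
  by rewrite -mulr_sumr P1 mulr1.
have [wC wD] : w *m C = w /\ w *m D = 0.
  move/eqP: tot; rewrite psumr_eq0 => [/allP h|j _]; last exact: addr_ge0.
  split; apply/rowP => j; have := h j (mem_index_enum j); rewrite /= paddr_eq0//.
    by rewrite subr_eq0 => /andP[/eqP].
  by rewrite [in RHS]mxE => /andP[_ /eqP].
have wP k : w *m (C + D) ^+ k = w.
  elim: k => [|k IHk]; first by rewrite expr0 mulmx1.
  by rewrite exprSr mulmxA IHk mulmxDr wC wD addr0.
have P0 k i j : 0 <= ((C + D) ^+ k) i j.
  elim: k i j => [|k IHk] i j; first by rewrite expr0 mxE ler0n.
  by rewrite exprSr mxE sumr_ge0// => l _; rewrite mulr_ge0// mxE addr_ge0.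
(* Irreducibility carries positive weight from a nonzero entry of [v] to row [i0], where [D] has a
   positive entry; this contradicts [w *m D = 0]. *)
have /rV0Pn[i vi] := v0.
have [k Pk] := irr i i0.
have wi0 : 0 < w ord0 i0.
  rewrite -(wP k) mxE (bigD1 i)//= ltr_wpDr//.
    by rewrite sumr_ge0// => l _; rewrite mulr_ge0.
  by rewrite mulr_gt0// mxE normr_gt0.
have := congr1 (fun u : 'rV_m => u ord0 j0) wD; rewrite /= !mxE => /eqP.
by rewrite gt_eqF// (bigD1 i0)//= ltr_wpDr ?mulr_gt0// sumr_ge0// => l _; rewrite mulr_ge0.
Qed.

Lemma massE {R : realType} {m : nat} (v : 'rV[R]_m) : mass v = \sum_j v ord0 j.
Proof. by rewrite /mass mxE; apply: eq_bigr => j _; rewrite mxE mulr1. Qed.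

(** * Steady state *)

Section SteadyState.
Context {R : realType} {m : nat}.
Variables (a b : nat) (C D : 'M[R]_m) (s : nat -> nat -> R).
Variables (pidle : nat -> 'rV[R]_m) (pbusy : nat -> nat -> nat -> 'rV[R]_m).
Hypothesis a_ge1 : (1 <= a)%N.
Hypothesis a_le_b : (a <= b)%N.
Hypothesis HCD : is_dmap C D.
Hypothesis Hsteady : steady_state a b C D s pidle pbusy.

Local Notation dep := (departure a b C D pbusy).
Local Notation depq := (departure_queue a b C D pbusy).
Local Notation Om := (Omega a b pbusy).

(** [T n] is the stationary mass of all busy states with queue length [n]; these masses sum to at
    most 1, hence tend to 0. *)
Lemma busy_mass_bound : exists T : nat -> R,
  (T @ \oo --> (0 : R))%classic /\
  forall n r K, (a <= r <= b)%N -> \sum_(1 <= u < K) mass (pbusy n r u) <= T n.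
Proof.
have mass0 n r u : (a <= r < b.+1)%N -> (1 <= u)%N -> 0 <= mass (pbusy n r u).
  by move=> rab u1; rewrite massE sumr_ge0// => j _; exact: (busy_ge0 Hsteady).
have sum0 n u : (1 <= u)%N -> 0 <= \sum_(a <= r < b.+1) mass (pbusy n r u).
  by move=> u1; rewrite big_nat_cond sumr_ge0// => r /andP[rab _]; exact: mass0.
pose e n := (\sum_(1 <= u <oo) (\sum_(a <= r < b.+1) mass (pbusy n r u))%:E)%E.
have e0 n : (0 <= e n)%E by apply: nneseries_ge0 => u u1 _; rewrite lee_fin sum0.
have idle0 : 0 <= \sum_(0 <= n < a) mass (pidle n).
  rewrite big_nat_cond sumr_ge0// => n /andP[na _].
  by rewrite massE sumr_ge0// => j _; exact: (idle_ge0 Hsteady).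
have e1 : (\sum_(0 <= n <oo) e n <= 1)%E.
  by rewrite -(total_mass Hsteady) -[leLHS]add0e leeD2r// lee_fin.
have sumle N : (\sum_(0 <= n < N) e n <= 1)%E.
  by apply: le_trans e1; apply: nneseries_lim_ge.
have efin n : e n \is a fin_num.
  rewrite ge0_fin_numE// (@le_lt_trans _ _ 1%E)// ?ltry//.
  rewrite (le_trans _ (sumle n.+1))// big_nat_recr//= leeDr//.
  exact: sume_ge0.
exists (fun n => fine (e n)); split.
  suff /cvg_series_cvg_0 : cvgn (series (fun n => fine (e n))) by [].
  apply: (is_cvg_nneg_series_bounded _ 1) => [k|K]; first exact: fine_ge0.
  rewrite -lee_fin -sumEFin; under eq_bigr do rewrite fineK//.
  exact: sumle.
move=> n r K rab; rewrite -lee_fin fineK//.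
apply: le_trans (nneseries_lim_ge K _); last by move=> u u1 _; rewrite lee_fin sum0.
rewrite sumEFin lee_fin big_nat_cond [leRHS]big_nat_cond.
apply: ler_sum => u /andP[/andP[u1 _] _].
rewrite (bigD1_seq r) ?mem_index_iota ?iota_uniq//= lerDl.
rewrite big_seq_cond sumr_ge0// => i /andP[]; rewrite mem_index_iota => iab _.
exact: mass0.
Qed.

(** * Departure vectors and elimination of the idle probabilities *)

Lemma departureE n r :
  dep n r = outflow C D (fun n u => Om *: pbusy n r u) n 1.
Proof.
rewrite /departure /outflow; case: n => [|n]; first by rewrite addr0 scalemxAl.
by rewrite scalerDr !scalemxAl.
Qed.

Lemma departure_queueE n : depq n = Om *: (\sum_(a <= r < b.+1) pbusy n r 1%N *m C +
  (if n is n'.+1 then \sum_(a <= r < b.+1) pbusy n' r 1%N *m D else 0)).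
Proof.
rewrite /departure_queue /departure -scaler_sumr; case: n => [|n]; first by rewrite addr0.
by rewrite big_split.
Qed.

Lemma departure_queue_gt0 n : (0 < n)%N ->
  depq n = Om *: (\sum_(a <= r < b.+1) pbusy n r 1%N *m C +
                  \sum_(a <= r < b.+1) pbusy n.-1 r 1%N *m D).
Proof. by case: n => // n _; exact: departure_queueE. Qed.

(** Invertibility of [1 - C] solves each idle equation for [pidle n *m D], with the previous idle
    flow as part of the input; each step adds one factor [Dbar]. *)
Lemma idle_departure n : (n < a)%N ->
  Om *: (pidle n *m D) = \sum_(0 <= k < n.+1) depq k *m Dbar C D ^+ (n.+1 - k).
Proof.
have IC := dmap_unitmx C D HCD.
have key (v w : 'rV[R]_m) : v = v *m C + w -> v *m D = w *m Dbar C D.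
  move=> vE; have -> : w = v *m (1%:M - C) by rewrite mulmxBr mulmx1 {1}vE addrAC subrr add0r.
  by rewrite /Dbar mulmxA mulmxK.
elim: n => [|n IHn] na.
  rewrite big_nat1 expr1 (key _ _ (idle_0 Hsteady)) departure_queueE addr0.
  by rewrite scalemxAl.
have nE : pidle n.+1 = pidle n.+1 *m C + (\sum_(a <= r < b.+1) pbusy n.+1 r 1%N *m C
     + \sum_(a <= r < b.+1) pbusy n r 1%N *m D + pidle n *m D).
  have n1 : (1 <= n.+1 <= a.-1)%N by move: (na); rewrite -[X in (_ < X)%N](prednK a_ge1) ltnS.
  rewrite {1}(idle_n Hsteady n1) /= -!addrA; congr (_ + (_ + _)); exact: addrC.
rewrite (key _ _ nE) mulmxDl scalerDr scalemxAl scalemxAl -departure_queueE.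
rewrite IHn ?(ltnW na)// [RHS]big_nat_recr//= subSnn expr1 addrC; congr (_ + _).
rewrite mulmx_suml; apply: eq_big_nat => k /andP[_ kn].
by rewrite -mulmxA mulmxE -exprSr -subSn ?(ltnW kn).
Qed.

(** Scaled flow of arrivals that bring an idle server from [a - 1] to [a] customers, expressed
    through departures only. *)
Definition idle_input : 'rV[R]_m := \sum_(0 <= k < a) depq k *m Dbar C D ^+ (a - k).

(** Scaled flow of batches of size [r] that start and leave [n] customers waiting. The idle term is
    a separate summand so that [a = b] is covered. *)
Definition batch_start (r n : nat) : 'rV[R]_m :=
  (if (n == 0%N) && (r == a) then idle_input else 0)
  + (if r == b then depq (n + b)%N else if n == 0%N then depq r else 0).

Lemma idle_inputE : Om *: (pidle a.-1 *m D) = idle_input.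
Proof. by rewrite idle_departure ?prednK. Qed.

(** The four busy balance equations become one recursion, in the form required by
    [outflow_gf_cvg]. *)
Lemma busy_rec r n u : (a <= r <= b)%N -> (1 <= u)%N ->
  Om *: pbusy n r u =
  outflow C D (fun n u => Om *: pbusy n r u) n u.+1 + s r u *: batch_start r n.
Proof.
move=> rab u1; rewrite /outflow /batch_start.
case: n => [|n] /=; last first.
  rewrite add0r; have [->|rb] := eqVneq r b.
    rewrite (busy_n_b Hsteady (ltn0Sn n) u1) /= departure_queueE addSn /=.
    by rewrite !scalerDr !scalemxAl !scalerA [Om * _]mulrC.
  have rab' : (a <= r < b)%N by case/andP: rab => ->; rewrite leq_eqVlt (negbTE rb).
  by rewrite (busy_n_r Hsteady (ltn0Sn n) rab' u1) /= scaler0 addr0 scalerDr !scalemxAl.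
rewrite addr0 -scalemxAl add0n.
(* At [n = 0] a full batch starts from exactly [b] customers and follows the same pattern as the
   smaller ones. *)
have -> : (if r == b then depq b else depq r) = depq r by case: eqP => [->|].
case/andP: rab; rewrite leq_eqVlt => /orP[/eqP <- _|ar rb].
  rewrite eqxx (busy_0_a Hsteady u1) departure_queue_gt0// -idle_inputE.
  by rewrite -scalerDr addrA scalerDr !scalerA [Om * _]mulrC.
have arb : (a.+1 <= r <= b)%N by rewrite ar.
rewrite gtn_eqF// add0r (busy_0_r Hsteady arb u1) departure_queue_gt0 ?(leq_ltn_trans _ ar)//.
by rewrite scalerDr !scalerA [Om * _]mulrC.
Qed.

Lemma departure_gf_cvg (x : R[i]) r : (a <= r <= b)%N -> is_service_law (s r) ->
  `|x| <= 1 ->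
  mxcvg (fun N => \sum_(0 <= n < N) x ^+ n *: cmx (dep n r) -
    (\sum_(0 <= n < N) x ^+ n *: cmx (batch_start r n)) *m Astar C D (s r) x) 0.
Proof.
move=> rab Hs x1; have [T [T0 busyT]] := busy_mass_bound.
rewrite [X in mxcvg X](_ : _ = fun N =>
    \sum_(0 <= n < N) x ^+ n *: cmx (outflow C D (fun n u => Om *: pbusy n r u) n 1) -
    (\sum_(0 <= n < N) x ^+ n *: cmx (batch_start r n)) *m Astar C D (s r) x); last first.
  by apply: funext => N; congr (_ - _); apply: eq_bigr => n _; rewrite departureE.
apply: (outflow_gf_cvg C D x HCD x1 (s r) _ _ (fun n => `|Om| * T n)) => //.
- by move=> n u; apply: busy_rec.
- by rewrite -[0](mulr0 `|Om|); apply: cvgMl_tmp.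
move=> n K; have -> : \sum_(1 <= u < K) l1norm (cmx (Om *: pbusy n r u))
    = (`|Om| * \sum_(1 <= u < K) mass (pbusy n r u))%:C%C.
  rewrite mulr_sumr rmorph_sum big_nat_cond [RHS]big_nat_cond.
  apply: eq_bigr => u /andP[/andP[u1 _] _] /=.
  rewrite massE mulr_sumr rmorph_sum; apply: eq_bigr => j _ /=.
  by rewrite !mxE normcR normrM (ger0_norm (busy_ge0 Hsteady n j rab u1)).
by rewrite lecR ler_wpM2l// busyT.
Qed.

(** Beyond [n = 0], a departure vector combines [pbusy] at two consecutive queue lengths with
    [u = 1], and each is bounded by the vanishing mass [T]. *)
Lemma departure_cvg0 r : (a <= r <= b)%N -> mxcvg (fun n => cmx (dep n r)) 0.
Proof.
move=> rab; have [T [T0 busyT]] := busy_mass_bound.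
have busy0 n j : 0 <= pbusy n r 1%N ord0 j by exact: (busy_ge0 Hsteady).
have p0 : mxcvg (fun n => cmx (pbusy n r 1%N)) 0.
  move=> i j; rewrite ord1 [X in (_ --> X)%classic]mxE; apply: cvg0_le_norm T0 => n.
  rewrite mxE normcR lecR ger0_norm// (le_trans _ (busyT n r 2%N rab))// big_nat1.
  by rewrite massE (bigD1 j)//= lerDl sumr_ge0.
have p1 := (mxcvg_shift 1 _ _).2 p0.
apply/(mxcvg_shift 1).
have := mxcvgZ Om%:C%C _ _ (mxcvgD _ _ _ _ (mxcvgMr (cmx C) _ _ p1) (mxcvgMr (cmx D) _ _ p0)).
rewrite !mul0mx addr0 scaler0; apply: eq_mxcvg => n.
by rewrite addn1 cmxZ cmxD !cmxM.
Qed.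

(** * Limits of the departure series at fixed [x] and [xi] *)

Section GeneratingFunction.
Variables x xi : R[i].
Hypothesis x_le1 : `|x| <= 1.
Hypothesis Hs : forall r, (a <= r <= b)%N -> is_service_law (s r).

Let A r := Astar C D (s r) x.
Let B := (x ^+ b)%:M - A b.
Let phi n := cmx (depq n).
Let Q := cmx idle_input.
Let F r N := \sum_(0 <= n < N) x ^+ n *: cmx (dep n r).
Let Phi N := \sum_(0 <= n < N) x ^+ n *: phi n.
Let L r := ((if r == a then Q else 0) + phi r) *m A r.

(** A batch with [r < b] leaves the queue empty when it starts, so the start series reduces to its
    [n = 0] term. *)
Lemma departure_gf_small r : (a <= r < b)%N -> mxcvg (F r) (L r).
Proof.
move=> /andP[ar rb]; have rab : (a <= r <= b)%N by rewrite ar ltnW.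
have H := departure_gf_cvg x r rab (Hs r rab) x_le1.
apply/(mxcvg_shift 1); have := mxcvgD _ _ _ _ ((mxcvg_shift 1 _ _).2 H) (mxcvg_cst (L r)).
rewrite add0r; apply: eq_mxcvg => N; rewrite addn1.
have -> : \sum_(0 <= n < N.+1) x ^+ n *: cmx (batch_start r n) =
    (if r == a then Q else 0) + phi r.
  rewrite big_nat_recl// [X in _ + X]big1 => [|n _].
    rewrite addr0 expr0 scale1r /batch_start eqxx /= (ltn_eqF rb) cmxD.
    by case: eqP => _; rewrite ?cmx0.
  by rewrite /batch_start (ltn_eqF rb) addr0 cmx0 scaler0.
by rewrite subrK.
Qed.

Lemma departure_gfE N :
  \sum_(0 <= n < N) \sum_(a <= r < b.+1) (x ^+ n * xi ^+ r) *: cmx (dep n r) =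
  \sum_(a <= r < b) xi ^+ r *: F r N + xi ^+ b *: F b N.
Proof.
rewrite exchange_big /= big_nat_recr//=; congr (_ + _).
  apply: eq_bigr => r _; rewrite scaler_sumr; apply: eq_bigr => n _.
  by rewrite scalerA mulrC.
by rewrite scaler_sumr; apply: eq_bigr => n _; rewrite scalerA mulrC.
Qed.

Lemma PhiE N : Phi N = \sum_(a <= r < b) F r N + F b N.
Proof.
rewrite -big_nat_recr//= exchange_big; apply: eq_bigr => n _ /=.
by rewrite -scaler_sumr /phi cmx_sum.
Qed.

(** The terms [x ^+ n *: phi n] vanish, so a block of [k] further terms is negligible whether or not
    [Phi] is known to converge. *)
Lemma Phi_shift_cvg k : mxcvg (fun N => Phi (N + k) - Phi N) 0.
Proof.
have phi0 : mxcvg (fun n => x ^+ n *: phi n) 0.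
  apply: (mxcvg0_l1norm phi) => [n|].
    by rewrite l1normZ normrX ler_piMl ?exprn_ile1// /l1norm sumr_ge0.
  apply: (eq_mxcvg (fun n => \sum_(a <= r < b.+1) cmx (dep n r))) => [n|].
    by rewrite /phi cmx_sum.
  have := mxcvg_sum_nat a b.+1 (fun r n => cmx (dep n r)) (fun=> 0) departure_cvg0.
  by rewrite big1.
elim: k => [|k IHk].
  by apply: (eq_mxcvg (fun=> 0)) (mxcvg_cst 0) => N; rewrite addn0 subrr.
have := mxcvgD _ _ _ _ IHk ((mxcvg_shift k _ _).2 phi0); rewrite addr0.
apply: eq_mxcvg => N; rewrite addnS /Phi [in RHS]big_nat_recr//=.
by rewrite addrAC.
Qed.

Let W := \sum_(0 <= n < b) x ^+ n *: phi n.

(** The factor [x ^+ b] turns [x ^+ n *: phi (n + b)] into term [n + b] of [Phi]; [W] gathers the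
    first [b] terms, which the shift misses. *)
Lemma batch_start_gf N :
  x ^+ b *: (\sum_(0 <= n < N.+1) x ^+ n *: cmx (batch_start b n)) =
  Phi (N.+1 + b) - W + (if b == a then x ^+ b *: Q else 0).
Proof.
have -> : \sum_(0 <= n < N.+1) x ^+ n *: cmx (batch_start b n) =
  (if b == a then Q else 0) + \sum_(0 <= n < N.+1) x ^+ n *: phi (n + b)%N.
  rewrite !big_nat_recl// /batch_start eqxx !eqxx /= cmxD scalerDr !addrA.
  congr (_ + _ + _); first by rewrite expr0 scale1r; case: eqP => // _; rewrite cmx0.
  by apply: eq_bigr => n _; rewrite add0r.
rewrite scalerDr [LHS]addrC; congr (_ + _); last by case: eqP; rewrite ?scaler0.
rewrite scaler_sumr /Phi [in RHS](big_cat_nat _ (n := b)) ?leq_addl//= addrAC subrr add0r.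
rewrite -[X in _ = \sum_(X <= _ < _) _]add0n big_addn addnK; apply: eq_bigr => n _.
by rewrite scalerA exprD mulrC.
Qed.

(** Limit of [x ^+ b] times the start series minus [F b], once [Phi] is split by [PhiE]. *)
Let Z := \sum_(a <= r < b) L r - W + (if b == a then x ^+ b *: Q else 0).

(** Up to convergent terms, [x ^+ b] times the start series is [F b] itself; moving this copy to the
    left, where it is multiplied by [A b], produces the factor [B]. *)
Lemma departure_gf_large : mxcvg (fun N => F b N *m B) (Z *m A b).
Proof.
have rab : (a <= b <= b)%N by rewrite a_le_b leqnn.
apply/(mxcvg_shift 1).
have H := mxcvgZ (x ^+ b) _ _ ((mxcvg_shift 1 _ _).2
  (departure_gf_cvg x b rab (Hs b rab) x_le1)).
have P := (mxcvg_shift 1 _ _).2 (Phi_shift_cvg b).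
have S : mxcvg (fun N => \sum_(a <= r < b) F r (N + 1)%N) (\sum_(a <= r < b) L r).
  by apply: mxcvg_sum_nat => r rb; apply: ((mxcvg_shift 1 _ _).2 (departure_gf_small r rb)).
have := mxcvgD _ _ _ _ H (mxcvgMr (A b) _ _ (mxcvgD _ _ _ _ P
  (mxcvgD _ _ _ _ S (mxcvg_cst ((if b == a then x ^+ b *: Q else 0) - W))))).
rewrite scaler0 !add0r [X in X *m A b](_ : _ = Z); last by rewrite /Z addrAC addrA.
apply: eq_mxcvg => N; rewrite addn1.
rewrite scalerBr scalemxAl batch_start_gf.
rewrite mulmxBr mul_mx_scalar -[LHS]addrA; congr (_ + _).
rewrite -/(A b) -2!mulNmx -mulmxDl; congr (_ *m _); rewrite (PhiE N.+1).
move: (Phi _) W (if _ then _ else _) (\sum_(a <= r < b) _) (F b N.+1) => p w q t f.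
apply/matrixP => i j; rewrite !mxE; ring.
Qed.

(** For [r = b] only the product with [B] has a known limit, so [B] and [invmx B] are inserted into
    every partial sum. *)
Lemma departure_gf_formula : B \in unitmx ->
  departure_gf a b C D pbusy x xi =
  (\sum_(a <= r < b) xi ^+ r *: (L r *m B) + xi ^+ b *: (Z *m A b)) *m invmx B.
Proof.
move=> Bu; apply: mxcvg_mxlim.
apply: (eq_mxcvg (fun N => (\sum_(a <= r < b) xi ^+ r *: (F r N *m B)
   + xi ^+ b *: (F b N *m B)) *m invmx B)) => [N|].
  rewrite departure_gfE mulmxDl mulmx_suml -scalemxAl mulmxK//; congr (_ + _).
  by apply: eq_bigr => r _; rewrite -scalemxAl mulmxK.
apply: mxcvgMr; apply: mxcvgD; last by apply: mxcvgZ; exact: departure_gf_large.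
by apply: mxcvg_sum_nat => r rb; apply: mxcvgZ; apply: mxcvgMr; exact: departure_gf_small.
Qed.

(** * Closed form of the numerator *)

Let Db := cmx (Dbar C D).

Lemma idle_input_gf : Q = \sum_(0 <= n < a) phi n *m Db ^+ (a - n).
Proof.
rewrite /Q cmx_sum; apply: eq_bigr => n _; rewrite cmxM; congr (_ *m _).
elim: (a - n)%N => [|k IHk]; first by rewrite !expr0; exact: map_mx1.
by rewrite !exprS -IHk; exact: cmxM.
Qed.

Lemma departure_gf_numerator :
  \sum_(a <= r < b) xi ^+ r *: (L r *m B) + xi ^+ b *: (Z *m A b) =
  \sum_(0 <= n < a) phi n *m
       ((xi ^+ b - xi ^+ a) *: (Db ^+ (a - n) *m A a *m A b)
        + (xi ^+ a * x ^+ b) *: (Db ^+ (a - n) *m A a)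
        - (xi ^+ b * x ^+ n) *: A b)
     + \sum_(a <= n < b) phi n *m
       ((xi ^+ b - xi ^+ n) *: (A n *m A b)
        + (xi ^+ n * x ^+ b) *: A n
        - (xi ^+ b * x ^+ n) *: A b).
Proof.
(* [G r V] is [xi ^+ r *: (V *m B) + xi ^+ b *: (V *m A b)] with [B] expanded. *)
pose G r (V : 'rV[R[i]]_m) : 'rV[R[i]]_m :=
  (xi ^+ b - xi ^+ r) *: (V *m A b) + (xi ^+ r * x ^+ b) *: V.
have GD r V V' : G r (V + V') = G r V + G r V'.
  by rewrite /G mulmxDl !scalerDr addrACA.
have sum1 : \sum_(0 <= n < a) phi n *m
       ((xi ^+ b - xi ^+ a) *: (Db ^+ (a - n) *m A a *m A b)
        + (xi ^+ a * x ^+ b) *: (Db ^+ (a - n) *m A a)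
        - (xi ^+ b * x ^+ n) *: A b) =
   G a (Q *m A a) - xi ^+ b *: ((\sum_(0 <= n < a) x ^+ n *: phi n) *m A b).
  rewrite /G idle_input_gf !mulmx_suml !scaler_sumr -big_split -sumrB.
  apply: eq_bigr => n _ /=; rewrite mulmxDr mulmxDr mulmxN -!scalemxAr -!mulmxA.
  by rewrite -!scalemxAl !scalerA.
have sum2 : \sum_(a <= n < b) phi n *m
       ((xi ^+ b - xi ^+ n) *: (A n *m A b)
        + (xi ^+ n * x ^+ b) *: A n
        - (xi ^+ b * x ^+ n) *: A b) =
   \sum_(a <= n < b) G n (phi n *m A n)
     - xi ^+ b *: ((\sum_(a <= n < b) x ^+ n *: phi n) *m A b).
  rewrite !mulmx_suml !scaler_sumr -sumrB.
  apply: eq_bigr => n _; rewrite /G /= mulmxDr mulmxDr mulmxN -!scalemxAr -!mulmxA.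
  by rewrite -!scalemxAl !scalerA.
rewrite sum1 sum2.
have LG : \sum_(a <= r < b) xi ^+ r *: (L r *m B)
    + xi ^+ b *: ((\sum_(a <= r < b) L r) *m A b) = \sum_(a <= r < b) G r (L r).
  rewrite mulmx_suml scaler_sumr -big_split; apply: eq_bigr => r _ /=.
  rewrite mulmxBr mul_mx_scalar scalerBr scalerA /G scalerBl.
  by rewrite -addrA [RHS]addrC [X in _ + X]addrC.
(* When [a < b] the idle input enters through [L a]. *)
have sumL : \sum_(a <= r < b) G r (L r) = \sum_(a <= r < b) G r (phi r *m A r)
    + (if b == a then 0 else G a (Q *m A a)).
  have -> : \sum_(a <= r < b) G r (L r) = \sum_(a <= r < b) G r (phi r *m A r)
     + \sum_(a <= r < b) (if r == a then G a (Q *m A a) else 0).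
    rewrite -big_split; apply: eq_bigr => r _ /=.
    rewrite /L mulmxDl GD addrC; case: eqP => [->//|_].
    by rewrite mul0mx /G mul0mx !scaler0 addr0.
  congr (_ + _); case: eqP => [->|/eqP ba]; first by rewrite big_geq.
  have ab : (a < b)%N by rewrite ltn_neqAle eq_sym ba.
  rewrite big_ltn// eqxx big_nat_cond big1 ?addr0// => r /andP[/andP[ar _] _].
  by rewrite gtn_eqF.
have WE : W = \sum_(0 <= n < a) x ^+ n *: phi n + \sum_(a <= n < b) x ^+ n *: phi n.
  by rewrite /W (big_cat_nat _ (n := a)).
(* When [a = b] the sum of the [L r] is empty and the idle input enters through [Z]; the coefficient
   [xi ^+ b - xi ^+ a] in [G a] is then zero. *)
have ZG : \sum_(a <= r < b) xi ^+ r *: (L r *m B) + xi ^+ b *: (Z *m A b) =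
    \sum_(a <= r < b) G r (L r) - xi ^+ b *: (W *m A b)
    + (if b == a then G a (Q *m A a) else 0).
  rewrite -LG /Z mulmxDl mulmxBl scalerDr scalerBr !addrA; congr (_ + _).
  case: eqP => [ba|_]; last by rewrite mul0mx scaler0.
  by rewrite -[a]ba /G subrr scale0r add0r -scalemxAl scalerA.
rewrite ZG sumL WE mulmxDl scalerDr.
move: (G a _) (\sum_(a <= r < b) G r _) (_ *: (_ *m A b)) (_ *: (_ *m A b)) => g h u v.
by case: eqP => _; apply/matrixP => i j; rewrite !mxE; ring.
Qed.
End GeneratingFunction.

End SteadyState.

Theorem mainTheorem2 (R : realType) (m a b : nat)
  (C D : 'M[R]_m) (s : nat -> nat -> R) (pibar : 'rV[R]_m)
  (pidle : nat -> 'rV[R]_m) (pbusy : nat -> nat -> nat -> 'rV[R]_m)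
  (m_ge1 : (1 <= m)%N) (a_ge1 : (1 <= a)%N) (a_le_b : (a <= b)%N)
  (HCD : is_dmap C D)
  (Hpibar : is_stationary (C + D) pibar)
  (Hs : forall r, (a <= r <= b)%N -> is_service_law (s r))
  (Hrho : traffic_intensity b D s pibar < 1)
  (Hsteady : steady_state a b C D s pidle pbusy)
  (x xi : R[i]) (x_le1 : `|x| <= 1) (xi_le1 : `|xi| <= 1)
  (Hinv : (x ^+ b)%:M - Astar C D (s b) x \in unitmx) :
  let A := fun r => Astar C D (s r) x in
  let Db := cmx (Dbar C D) in
  let phi := fun n => cmx (departure_queue a b C D pbusy n) in
  departure_gf a b C D pbusy x xi =
    (\sum_(0 <= n < a) phi n *m
       ((xi ^+ b - xi ^+ a) *: (Db ^+ (a - n) *m A a *m A b)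
        + (xi ^+ a * x ^+ b) *: (Db ^+ (a - n) *m A a)
        - (xi ^+ b * x ^+ n) *: A b)
     + \sum_(a <= n < b) phi n *m
       ((xi ^+ b - xi ^+ n) *: (A n *m A b)
        + (xi ^+ n * x ^+ b) *: A n
        - (xi ^+ b * x ^+ n) *: A b))
    *m invmx ((x ^+ b)%:M - A b).
Proof.
rewrite /= (departure_gf_formula a b C D s pidle pbusy a_ge1 a_le_b HCD Hsteady
  x xi x_le1 Hs Hinv).
by rewrite (departure_gf_numerator a b C D s pbusy a_le_b x xi).
Qed.
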